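(* Let $G=(V,w,m)$ be a locally finite, connected, complete weighted graph with non-degenerate vertex measure, satisfying the curvature dimension condition $CD(K,n)$ for some $K>0$ and $0<n<\infty$, and with $\operatorname{Deg}_{\max}<\infty$. Then for all $x_0,y_0\in V$, $$\rho(x_0,y_0)\le \sqrt{\frac{n}{K}}\left(\arcsin\frac{1}{\sqrt{\frac{Kn}{2\operatorname{Deg}(x_0)}+1}}+\arcsin\frac{1}{\sqrt{\frac{Kn}{2\operatorname{Deg}(y_0)}+1}}\right).$$
   Context: A weighted graph is a triple $G=(V,w,m)$ with $V$ countable, $w:V^2\to[0,\infty)$ symmetric with $w(x,x)=0$ for all $x$, and $m:V\to(0,\infty)$. Write $x\sim y$ if $w(x,y)>0$. The measure $m$ is non-degenerate if $\inf_{x\in V}m(x)>0$. $G$ is locally finite if $\deg(x):=\sum_{y\in V}w(x,y)<\infty$ for all $x\in V$, and connected if any two vertices $x,y$ are joined by a finite sequence $x=x_0\sim x_1\sim\cdots\sim x_k=y$. Set $\operatorname{Deg}(x):=\deg(x)/m(x)$ and $\operatorname{Deg}_{\max}:=\sup_{x\in V}\operatorname{Deg}(x)$. The graph Laplacian is $\Delta f(x)=\frac{1}{m(x)}\sum_{y\in V}w(x,y)(f(y)-f(x))$. The Bakry–Émery operators are $2\Gamma(f,g)=\Delta(fg)-f\Delta g-g\Delta f$ and $2\Gamma_2(f,g)=\Delta\Gamma(f,g)-\Gamma(f,\Delta g)-\Gamma(g,\Delta f)$, with $\Gamma f=\Gamma(f,f)$, $\Gamma_2(f)=\Gamma_2(f,f)$;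 explicitly $\Gamma f(x)=\frac{1}{2m(x)}\sum_y w(x,y)(f(y)-f(x))^2$. $G$ satisfies $CD(K,n)$ ($K\in\mathbb{R}$, $n\in(0,\infty]$) if $\Gamma_2(f)\ge \frac1n(\Delta f)^2+K\Gamma f$ pointwise for all functions $f:V\to\mathbb{R}$. ''Complete'' here (not the combinatorial complete graph) means: there exists a non-decreasing sequence of finitely supported functions $\eta_k:V\to\mathbb{R}$ with $\eta_k\to 1$ pointwise and $\Gamma\eta_k\le 1/k$ for all $k$. The resistance distance is $\rho(x,y):=\sup\{|f(y)-f(x)| : f:V\to\mathbb{R},\ \sup_{z\in V}\Gamma f(z)\le 1\}$. *)

(* Defs.v *)
From HB Require Import structures.
From mathcomp Require Import all_boot all_order all_algebra.
From mathcomp Require Import all_classical all_reals all_analysis.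

Set Implicit Arguments.
Unset Strict Implicit.
Unset Printing Implicit Defensive.

Import Order.TTheory GRing.Theory Num.Theory.
Import numFieldNormedType.Exports.

Local Open Scope classical_set_scope.
Local Open Scope ring_scope.

(* Unordered sum of a real family; it is meaningful only for absolutely
   summable families, i.e. under [rsummable]. *)
Definition rsummable (R : realType) (T : choiceType) (f : T -> R) : Prop :=
  summable [set: T] (EFin \o f).

Definition rsum (R : realType) (T : choiceType) (f : T -> R) : R :=
  fine (esum [set: T] ((EFin \o f)^\+)%E - esum [set: T] ((EFin \o f)^\-)%E)%E.

Record wgraph (R : realType) (V : countType) := WGraph {
  weight : V -> V -> R;
  vmeas : V -> R;
  weight_ge0 : forall x y, 0 <= weight x y;
  weight_sym : forall x y, weight x y = weight y x;
  weight_diag : forall x, weight x x = 0;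
  vmeas_gt0 : forall x, 0 < vmeas x }.

Section WeightedGraph.
Context (R : realType) (V : countType) (G : wgraph R V).
Local Notation w := (weight G).
Local Notation m := (vmeas G).
Implicit Types (f g : V -> R) (x y z : V).

Definition adj : rel V := fun x y => 0 < w x y.

Definition nondegenerate_measure : Prop := (0 < ereal_inf (range (EFin \o m)))%E.

Definition deg x : \bar R := \esum_(y in [set: V]) (w x y)%:E.

(* A vertex may have infinitely many neighbours. *)
Definition locally_finite : Prop := forall x, (deg x < +oo)%E.

Definition connected_wgraph : Prop :=
  forall x y, exists p : seq V, path adj x p /\ last x p = y.

Definition Deg x : R := fine (deg x) / m x.

Definition Deg_max : \bar R := ereal_sup (range (EFin \o Deg)).

(* Since neighbourhoods may be infinite, the series defining the Laplacian need
   not converge for every function; [lap_dom] is the domain of the operator.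
   It is all of [V -> R] as soon as every vertex has finitely many
   neighbours. *)
Definition lap_dom f : Prop :=
  forall x, rsummable (fun y => w x y * (f y - f x)).

Definition lap f : V -> R :=
  fun x => (m x)^-1 * rsum (fun y => w x y * (f y - f x)).

Definition Gamma f g : V -> R :=
  fun x => 2^-1 * (lap (f \* g) x - f x * lap g x - g x * lap f x).

Definition Gamma2 f g : V -> R :=
  fun x => 2^-1 * (lap (Gamma f g) x - Gamma f (lap g) x - Gamma g (lap f) x).

(* [f] and [f ^ 2] are in the domain of the Laplacian.  On a locally finite
   graph this says that sum_y w(x,y) (f y - f x)^2 is finite for all x, by
   Cauchy-Schwarz. *)
Definition Gamma_dom f : Prop := lap_dom f /\ lap_dom (f \* f).

(* The functions for which every Laplacian occurring in [Gamma2 f f] is given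
   by convergent series. *)
Definition Gamma2_dom f : Prop :=
  [/\ Gamma_dom f, lap_dom (lap f), lap_dom (f \* lap f) &
      lap_dom (Gamma f f)].

(* The dimension lies in ]0, +oo], with 1 / +oo = 0. *)
Definition CD (K : R) (n : \bar R) : Prop :=
  forall f, Gamma2_dom f -> forall x,
    fine (n^-1)%E * lap f x ^+ 2 + K * Gamma f f x <= Gamma2 f f x.

(* The index k = 0 is unconstrained in the bound on Gamma. *)
Definition complete_wgraph : Prop :=
  exists eta : nat -> V -> R,
    [/\ forall k, finite_set [set x | eta k x != 0],
        forall x, {homo (fun k => eta k x) : k l / (k <= l)%N >-> k <= l},
        forall x, (fun k => eta k x) @ \oo --> (1 : R) &
        forall k, (0 < k)%N ->
          forall x, Gamma (eta k) (eta k) x <= k%:R^-1].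

(* A function for which Gamma f is not given by convergent series has
   Gamma f = +oo somewhere, hence is not a competitor. *)
Definition resistance_dist x y : \bar R :=
  ereal_sup [set (`|f y - f x|)%:E |
    f in [set f | Gamma_dom f /\ forall z, Gamma f f z <= 1]].

(* arcsin (1 / sqrt (K n / (2 Deg x) + 1)).  An isolated vertex has Deg x = 0;
   then K n / (2 Deg x) = +oo and the term is arcsin 0 = 0, whereas division by
   zero in R would give arcsin 1. *)
Definition arcsin_term (K n : R) x : R :=
  if Deg x == 0 then 0
  else asin (1 / Num.sqrt (K * n / (2 * Deg x) + 1)).

End WeightedGraph.

(* Main.v *)
(** A function competing for the resistance distance may be truncated between
its two values of interest, so it can be taken bounded: [`|f| <= B] and
[Gamma f <= 1]. The heat semigroup is replaced by iterates of the Euler step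
[Q = 1 + h Delta], which for [h Deg_max <= 1] is a Markov operator on bounded
functions. Curvature-dimension and Jensen give
[Q (Gamma u) >= (1 + 2hK) Gamma (Q u) + (2h/n) (Delta Q u)^2 - C h^2]; iterating
from [f], the functions [u_N = Q^N f] satisfy, with [v = (1 + 2hK)^(-N/2)],
[Gamma u_N + (1 - v^2) / (Kn) (Delta u_N)^2 <= v^2 + O(h)].
Since [(Delta u)^2 <= 2 Deg (Gamma u)], this bounds [Delta u_N (x)] by
[sqrt (Kn) s v / sqrt (1 - s^2 v^2)] up to [O(sqrt h)], where
[s = (Kn / (2 Deg x) + 1)^(-1/2)], and the sum of [h |Delta u_N (x)|] telescopes
against [asin (s v)], which bounds [|f x - u_N x|] by [sqrt (n/K) asin s] in
the limit. As [Gamma u_N] tends to [0] uniformly, so does [u_N x - u_N y] along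
a path from [x] to [y]. *)

Require Import Defs.
From HB Require Import structures.
From mathcomp Require Import all_boot all_order all_algebra.
From mathcomp Require Import all_classical all_reals all_analysis.
From mathcomp Require Import ring lra.

Set Implicit Arguments.
Unset Strict Implicit.
Unset Printing Implicit Defensive.

Import Order.TTheory GRing.Theory Num.Theory.
Import numFieldNormedType.Exports.

Local Open Scope classical_set_scope.
Local Open Scope ring_scope.

(** * Unordered sums *)

Lemma esumZl (R : realType) (T : choiceType) (D : set T) (a : T -> \bar R)
    (r : R) : 0 <= r -> (forall t, 0 <= a t)%E ->
  (\esum_(t in D) (r%:E * a t) = r%:E * \esum_(t in D) a t)%E.
Proof.
move=> r0 a0; rewrite /esum -ereal_supZl//; last first.
  by apply/set0P/image_nonempty; exists set0; exact: fsets_set0.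
congr ereal_sup; rewrite image_comp; apply: eq_imagel => A [finA _] /=.
by rewrite ge0_mule_fsumr.
Qed.

Section RSum.
Context (R : realType) (T : choiceType).
Implicit Types (f g u v : T -> R).

Lemma rsummable_le f g : (forall t, `|f t| <= g t) -> rsummable g -> rsummable f.
Proof.
move=> fg; apply: le_lt_trans; apply: le_esum => t _ /=.
by rewrite lee_fin (le_trans (fg t))// ler_norm.
Qed.

Lemma rsummableD f g : rsummable f -> rsummable g ->
  rsummable (fun t => f t + g t).
Proof. by move=> fs gs; have := summableD fs gs. Qed.

Lemma rsummableZ c f : rsummable f -> rsummable (fun t => c * f t).
Proof.
move=> fs; rewrite /rsummable /summable.
under eq_esum do rewrite /= normrM EFinM.
by rewrite esumZl// lte_mul_pinfty.
Qed.

Let possum f : R := fine (\esum_(t in [set: T]) (f t)%:E).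

Let possum_fin f : (forall t, 0 <= f t) -> rsummable f ->
  \esum_(t in [set: T]) (f t)%:E \is a fin_num.
Proof.
move=> f0 fs; rewrite ge0_fin_numE; last by apply: esum_ge0 => t _; rewrite lee_fin.
by apply: le_lt_trans fs; apply: le_esum => t _ /=; rewrite lee_fin ler_norm.
Qed.

(** Any way of writing a family as a difference of nonnegative summable families computes its sum,
    not only the canonical one; linearity of [rsum] rests on this freedom. *)
Let rsumB_ge0 u v : (forall t, 0 <= u t) -> (forall t, 0 <= v t) ->
  rsummable u -> rsummable v -> rsum (fun t => u t - v t) = possum u - possum v.
Proof.
move=> u0 v0 us vs; rewrite /rsum.
have -> : EFin \o (fun t => u t - v t) = ((EFin \o u) \- (EFin \o v))%E by [].
rewrite esumB//; last 2 first.
- by move=> t _; rewrite lee_fin.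
- by move=> t _; rewrite lee_fin.
by rewrite fineB//; exact: possum_fin.
Qed.

Let possumD u v : (forall t, 0 <= u t) -> (forall t, 0 <= v t) ->
  rsummable u -> rsummable v ->
  possum (fun t => u t + v t) = possum u + possum v.
Proof.
move=> u0 v0 us vs; rewrite /possum -fineD//; last 2 first.
- exact: possum_fin.
- exact: possum_fin.
by rewrite -esumD// => t _; rewrite lee_fin.
Qed.

Let pos f t : R := (`|f t| + f t) / 2.
Let neg f t : R := (`|f t| - f t) / 2.

Let pos_ge0 f t : 0 <= pos f t.
Proof. by rewrite /pos; have := ler_norm (- f t); rewrite normrN; lra. Qed.

Let neg_ge0 f t : 0 <= neg f t.
Proof. by rewrite /neg; have := ler_norm (f t); lra. Qed.

Let rsummable_pos f : rsummable f -> rsummable (pos f).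
Proof.
move=> fs; apply: (rsummable_le (g := fun t => `|f t|)) => [t|].
  by rewrite ger0_norm// /pos; have := ler_norm (f t); lra.
rewrite /rsummable /summable.
by under eq_esum do rewrite /= normr_id.
Qed.

Let rsummable_neg f : rsummable f -> rsummable (neg f).
Proof.
move=> fs; have -> : neg f = pos (fun t => -1 * f t).
  by apply/funext => t; rewrite /neg /pos mulN1r normrN.
exact/rsummable_pos/rsummableZ.
Qed.

(** Positive parts are not additive, but [pos f + pos g] and [neg f + neg g] are nonnegative
    summable families with difference [f + g], which is all that [rsumB_ge0] asks for. *)
Lemma rsumD f g : rsummable f -> rsummable g ->
  rsum (fun t => f t + g t) = rsum f + rsum g.
Proof.
move=> fs gs.
have decomp h : h = (fun t => pos h t - neg h t).
  by apply/funext => t; rewrite /pos /neg; lra.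
have -> : (fun t => f t + g t) =
    (fun t => (pos f t + pos g t) - (neg f t + neg g t)).
  by apply/funext => t; rewrite /pos /neg; lra.
have [pf pg] := (rsummable_pos fs, rsummable_pos gs).
have [nf ng] := (rsummable_neg fs, rsummable_neg gs).
rewrite rsumB_ge0; last 4 first.
- by move=> t; rewrite addr_ge0.
- by move=> t; rewrite addr_ge0.
- exact: rsummableD.
- exact: rsummableD.
rewrite {3}(decomp f) {3}(decomp g).
by rewrite (rsumB_ge0 (u := pos f))// (rsumB_ge0 (u := pos g))// !possumD//; ring.
Qed.

Lemma rsummable0 : rsummable (fun _ : T => 0 : R).
Proof. by rewrite /rsummable /summable esum1// => t _ /=; rewrite normr0. Qed.

Lemma rsum0 : rsum (fun _ : T => 0 : R) = 0.
Proof.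
have := rsumD rsummable0 rsummable0.
by under [X in rsum X = _]eq_fun do rewrite addr0; lra.
Qed.

Lemma rsum_ge0E f : (forall t, 0 <= f t) -> rsummable f ->
  rsum f = fine (\esum_(t in [set: T]) (f t)%:E).
Proof.
move=> f0 fs; have := rsumB_ge0 f0 (fun=> lexx 0) fs rsummable0.
under [X in rsum X = _]eq_fun do rewrite subr0.
by move=> ->; rewrite /possum [X in _ - fine X]esum1// subr0.
Qed.

Lemma rsum_ge0 f : (forall t, 0 <= f t) -> rsummable f -> 0 <= rsum f.
Proof.
move=> f0 fs; rewrite rsum_ge0E//; apply: fine_ge0.
by apply: esum_ge0 => t _; rewrite lee_fin.
Qed.

Lemma rsum_ge_term f t : (forall t, 0 <= f t) -> rsummable f -> f t <= rsum f.
Proof.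
move=> f0 fs; rewrite rsum_ge0E// -lee_fin fineK; last exact: possum_fin.
apply: esum_ge; exists [set t]; first by split.
by rewrite fsbig_set1.
Qed.

Lemma rsumN f : rsummable f -> rsum (fun t => - f t) = - rsum f.
Proof.
move=> fs; have fNs : rsummable (fun t => - f t).
  by have := rsummableZ (-1) fs; under eq_fun do rewrite mulN1r.
apply/eqP; rewrite -addr_eq0 -rsumD//.
by under eq_fun do rewrite addNr; rewrite rsum0.
Qed.

Lemma rsumZ c f : rsummable f -> rsum (fun t => c * f t) = c * rsum f.
Proof.
have rsumZ_ge0 (a : R) (h : T -> R) : 0 <= a -> rsummable h ->
    rsum (fun t => a * h t) = a * rsum h.
  move=> a0 hs; have decomp : h = (fun t => pos h t - neg h t).
    by apply/funext => t; rewrite /pos /neg; lra.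
  have possumZ (u : T -> R) : (forall t, 0 <= u t) -> rsummable u ->
      possum (fun t => a * u t) = a * possum u.
    move=> u0 us; rewrite /possum; under eq_esum do rewrite EFinM.
    by rewrite esumZl// fineM//; exact: possum_fin.
  have [ph nh] := (rsummable_pos hs, rsummable_neg hs).
  rewrite [in RHS]decomp (rsumB_ge0 (u := pos h))//.
  have -> : (fun t => a * h t) = (fun t => a * pos h t - a * neg h t).
    by apply/funext => t; rewrite /pos /neg; lra.
  rewrite (rsumB_ge0 (u := fun t => a * pos h t)) ?possumZ//.
  - by ring.
  - by move=> t; exact: mulr_ge0.
  - by move=> t; exact: mulr_ge0.
  - exact: rsummableZ.
  - exact: rsummableZ.
move=> fs; have [c0|c0] := leP 0 c; first exact: rsumZ_ge0.
have -> : (fun t => c * f t) = (fun t => - (- c * f t)).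
  by apply/funext => t; rewrite mulNr opprK.
rewrite rsumN; last exact: rsummableZ.
by rewrite rsumZ_ge0// ?mulNr ?opprK// oppr_ge0 ltW.
Qed.

Lemma ler_rsum f g : rsummable f -> rsummable g -> (forall t, f t <= g t) ->
  rsum f <= rsum g.
Proof.
move=> fs gs fg; have fNs : rsummable (fun t => -1 * f t) by exact: rsummableZ.
rewrite -subr_ge0 -mulN1r -rsumZ// -rsumD//; apply: rsum_ge0.
  by move=> t; have := fg t; lra.
exact: rsummableD.
Qed.

End RSum.

(** * The Laplacian and the carre du champ *)

Section Laplacian.
Context (R : realType) (V : countType) (G : wgraph R V).
Context (hlf : locally_finite G).
Local Notation w := (weight G).
Local Notation m := (vmeas G).
Implicit Types (f g : V -> R) (x y : V).

Lemma rsummable_weight x : rsummable (w x).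
Proof.
apply: le_lt_trans (hlf x); apply: le_esum => y _ /=.
by rewrite lee_fin ger0_norm// weight_ge0.
Qed.

Lemma DegE x : Deg G x = rsum (w x) / m x.
Proof. by rewrite rsum_ge0E//; [exact: weight_ge0|exact: rsummable_weight]. Qed.

Lemma Deg_ge0 x : 0 <= Deg G x.
Proof.
rewrite DegE divr_ge0//; last exact/ltW/vmeas_gt0.
by apply: rsum_ge0; [exact: weight_ge0|exact: rsummable_weight].
Qed.

Lemma lap_domD a f g : lap_dom G f -> lap_dom G g ->
  lap_dom G (fun y => a * f y + g y).
Proof.
move=> fd gd x; have := rsummableD (rsummableZ a (fd x)) (gd x).
by congr (rsummable _); apply/funext => y; ring.
Qed.

Lemma lapD a f g x : lap_dom G f -> lap_dom G g ->
  lap G (fun y => a * f y + g y) x = a * lap G f x + lap G g x.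
Proof.
move=> fd gd; rewrite /lap mulrCA -mulrDr -(rsumZ a (fd x)).
rewrite -rsumD; [|exact: rsummableZ (fd x)|exact: (gd x)].
by congr (_ * rsum _); apply/funext => y; ring.
Qed.

Lemma lap_cst c x : lap G (fun=> c) x = 0.
Proof.
rewrite /lap; under [X in rsum X]eq_fun do rewrite subrr mulr0.
by rewrite rsum0 mulr0.
Qed.

Lemma lap_dom_cst c : lap_dom G (fun=> c).
Proof. by move=> x; under eq_fun do rewrite subrr mulr0; exact: rsummable0. Qed.

(** Dropping the terms [w x y * f y] leaves only the part proportional to [f x]. This one-sided
    bound yields both the boundedness of [lap] and the positivity of Euler steps. *)
Lemma lap_ge f x : lap_dom G f -> (forall y, 0 <= f y) ->
  - (Deg G x * f x) <= lap G f x.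
Proof.
move=> fd f0; have := rsummableZ (- f x) (rsummable_weight x).
rewrite DegE -mulrA mulrC -mulrA -mulrN /lap ler_pM2l; last first.
  by rewrite invr_gt0 vmeas_gt0.
move=> ws; rewrite -mulNr -rsumZ//; last exact: rsummable_weight.
apply: ler_rsum => // y; have := mulr_ge0 (weight_ge0 G x y) (f0 y); lra.
Qed.

Lemma Gamma_summable f x : Gamma_dom G f ->
  rsummable (fun y => w x y * (f y - f x) ^+ 2).
Proof.
move=> [fd f2d]; have := rsummableD (f2d x) (rsummableZ (- (2 * f x)) (fd x)).
congr (rsummable _); apply/funext => y /=; ring.
Qed.

(** Comes from [f y ^+ 2 - f x ^+ 2 - 2 * f x * (f y - f x) = (f y - f x) ^+ 2], where [Gamma_dom]
    makes both series on the left converge. *)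
Lemma GammaE f x : Gamma_dom G f ->
  Gamma G f f x = (2 * m x)^-1 * rsum (fun y => w x y * (f y - f x) ^+ 2).
Proof.
move=> [fd f2d]; rewrite /Gamma invfM -[RHS]mulrA; congr (_ * _).
rewrite (_ : (fun y => _) = (fun y => w x y * ((f \* f) y - (f \* f) x) +
    - (2 * f x) * (w x y * (f y - f x)))); last by apply/funext => y /=; ring.
rewrite rsumD; [|exact: (f2d x)|exact: rsummableZ (fd x)].
rewrite rsumZ; last exact: (fd x).
by rewrite /lap; ring.
Qed.

Lemma Gamma_ge0 f x : Gamma_dom G f -> 0 <= Gamma G f f x.
Proof.
move=> fd; rewrite GammaE// mulr_ge0//.
  by rewrite invr_ge0 mulr_ge0// ltW// vmeas_gt0.
apply: rsum_ge0; last exact: Gamma_summable.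
by move=> y; rewrite mulr_ge0 ?weight_ge0 ?sqr_ge0.
Qed.

Lemma Gamma_le_contraction f g x : Gamma_dom G f -> Gamma_dom G g ->
  (forall y z, `|g y - g z| <= `|f y - f z|) -> Gamma G g g x <= Gamma G f f x.
Proof.
move=> fd gd gf; rewrite !GammaE// ler_pM2l; last first.
  by rewrite invr_gt0 mulr_gt0// vmeas_gt0.
apply: ler_rsum; [exact: Gamma_summable..|move=> y].
rewrite ler_wpM2l ?weight_ge0// -[leLHS]real_normK ?num_real//.
by rewrite -[leRHS]real_normK ?num_real// lerXn2r ?nnegrE.
Qed.

Lemma Gamma_adj f x y : Gamma_dom G f -> adj G x y ->
  (f y - f x) ^+ 2 <= 2 * m x / w x y * Gamma G f f x.
Proof.
move=> fd xy; have w0 : 0 < w x y by [].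
have m0 := vmeas_gt0 G x.
rewrite GammaE//; set S := rsum _.
have -> : 2 * m x / w x y * ((2 * m x)^-1 * S) = S / w x y.
  by field; rewrite !gt_eqF.
rewrite ler_pdivlMr// mulrC {}/S.
apply: (rsum_ge_term (f := fun y => w x y * (f y - f x) ^+ 2)); last first.
  exact: Gamma_summable.
by move=> z; rewrite mulr_ge0 ?weight_ge0 ?sqr_ge0.
Qed.

(** Cauchy-Schwarz for the weights [w x], read off from the sign of a quadratic polynomial. *)
Lemma lap_sqr_le f x : Gamma_dom G f ->
  lap G f x ^+ 2 <= 2 * Deg G x * Gamma G f f x.
Proof.
move=> fd; have [fld _] := fd; have m0 := vmeas_gt0 G x.
(* Up to the factor [m x], this polynomial in [c] is the sum of
   [w x y * (1 + c * (f y - f x)) ^+ 2]. *)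
have quad c : 0 <= Deg G x + 2 * c * lap G f x + 2 * c ^+ 2 * Gamma G f f x.
  have s1 := rsummable_weight x.
  have s2 := rsummableZ (2 * c) (fld x).
  have s3 := rsummableZ (c ^+ 2) (Gamma_summable x fd).
  have := rsum_ge0 _ (rsummableD (rsummableD s1 s2) s3).
  rewrite rsumD//; last exact: rsummableD.
  rewrite rsumD// !rsumZ//; last exact: Gamma_summable.
  rewrite GammaE// DegE /lap => H.
  have {}H := H _; rewrite -(pmulr_rge0 _ m0); apply: le_trans (H _) _.
    move=> y; rewrite (_ : _ + _ = w x y * (1 + c * (f y - f x)) ^+ 2); last by ring.
    by rewrite mulr_ge0 ?weight_ge0 ?sqr_ge0.
  by rewrite le_eqVlt; apply/orP; left; apply/eqP; field; rewrite gt_eqF.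
have := Gamma_ge0 x fd; have := Deg_ge0 x; move: quad.
move: (Deg G x) (lap G f x) (Gamma G f f x) => d l e quad d0.
rewrite le_eqVlt => /predU1P[e0|e0].
  rewrite -e0 mulr0; have [->|l0] := eqVneq l 0; first by rewrite expr0n.
  (* Without a quadratic term, a nonzero [l] would let the polynomial take the value [-1]. *)
  have := quad (- (d + 1) / (2 * l)); rewrite -e0 mulr0 addr0.
  have -> : 2 * (- (d + 1) / (2 * l)) * l = - (d + 1) by field.
  lra.
(* Otherwise evaluate at the minimiser. *)
have := quad (- l / (2 * e)).
have -> : d + 2 * (- l / (2 * e)) * l + 2 * (- l / (2 * e)) ^+ 2 * e =
    (2 * d * e - l ^+ 2) / (2 * e) by field; rewrite gt_eqF.
by rewrite pmulr_lge0 ?invr_gt0 ?mulr_gt0// subr_ge0.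
Qed.

End Laplacian.

(** * Euler steps of the heat equation on bounded functions *)

Section HeatStep.
Context (R : realType) (V : countType) (G : wgraph R V).
Context (hlf : locally_finite G) (D : R) (hD : forall x, Deg G x <= D).
Implicit Types (f g u : V -> R) (x y : V) (B C : R).

Definition bounded_by B f := forall x, `|f x| <= B.

Lemma bounded_byD a B C f g : bounded_by B f -> bounded_by C g ->
  bounded_by (`|a| * B + C) (fun y => a * f y + g y).
Proof.
move=> fB gC x; rewrite (le_trans (ler_normD _ _))// lerD// normrM.
by rewrite ler_wpM2l.
Qed.

Lemma bounded_byM B C f g : bounded_by B f -> bounded_by C g ->
  bounded_by (B * C) (f \* g).
Proof. by move=> fB gC x; rewrite normrM ler_pM. Qed.

Lemma bounded_by_cst c : bounded_by `|c| (fun=> c).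
Proof. by move=> x. Qed.

(** Neighbourhoods may be infinite, but the increments of [f] are at most [2 * B] and the weights at
    [x] are summable. Bounded functions thus form a class on which all operators below are
    defined. *)
Lemma bounded_lap_dom B f : bounded_by B f -> lap_dom G f.
Proof.
move=> fB x; apply: rsummable_le (rsummableZ (B + B) (rsummable_weight hlf x)).
move=> y; rewrite normrM ger0_norm ?weight_ge0// mulrC ler_wpM2r ?weight_ge0//.
by rewrite (le_trans (ler_normB _ _))// lerD.
Qed.

Lemma bounded_Gamma_dom B f : bounded_by B f -> Gamma_dom G f.
Proof.
move=> fB; split; first exact: bounded_lap_dom fB.
exact: bounded_lap_dom (bounded_byM fB fB).
Qed.

Lemma bounded_lap B f : bounded_by B f -> bounded_by (2 * D * B) (lap G f).
Proof.
move=> fB x; have fd := bounded_lap_dom fB.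
have B0 : 0 <= B by apply: le_trans (fB x).
(* Apply [lap_ge] to [B - g >= 0]; the lower bound then follows by passing to [- f]. *)
have upper (g : V -> R) : bounded_by B g -> lap G g x <= 2 * D * B.
  move=> gB; have gd := bounded_lap_dom gB.
  have cd := @lap_dom_cst _ _ G B.
  have := lap_ge hlf x (lap_domD (-1) gd cd).
  rewrite lapD// lap_cst => H; have {}H := H _.
  have : - (Deg G x * (-1 * g x + B)) <= -1 * lap G g x + 0.
    by apply: H => y; have := ler_norm (g y); have := gB y; lra.
  have := mulr_ge0 (Deg_ge0 hlf x) B0; have := ler_wpM2r B0 (hD x).
  have : - Deg G x * B <= Deg G x * g x.
    rewrite mulNr -mulrN ler_wpM2l ?Deg_ge0//.
    by have := ler_norm (- g x); rewrite normrN; have := gB x; lra.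
  lra.
rewrite ler_norml upper// andbT.
have := upper (fun y => -1 * f y + 0).
rewrite lapD ?lap_cst; [|by []|exact: lap_dom_cst].
suff fN : bounded_by B (fun y => -1 * f y + 0) by move=> /(_ fN); lra.
by move=> y; rewrite addr0 mulN1r normrN.
Qed.

(** Each of the three Laplacian terms contributes [2 * D * B * C], and [Gamma] halves their sum. *)
Lemma bounded_Gamma B C f g : bounded_by B f -> bounded_by C g ->
  bounded_by (3 * D * B * C) (Gamma G f g).
Proof.
move=> fB gC x; rewrite /Gamma normrM ger0_norm ?invr_ge0//.
have H1 := bounded_lap (bounded_byM fB gC) x.
have H2 := bounded_byM fB (bounded_lap gC) x.
have H3 := bounded_byM gC (bounded_lap fB) x.
have := le_trans (ler_normB _ _) (lerD (le_trans (ler_normB _ _) (lerD H1 H2)) H3).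
by rewrite /=; lra.
Qed.

Lemma bounded_Gamma2_dom B f : bounded_by B f -> Gamma2_dom G f.
Proof.
move=> fB; split; [exact: bounded_Gamma_dom fB| | |].
- exact: bounded_lap_dom (bounded_lap fB).
- exact: bounded_lap_dom (bounded_byM fB (bounded_lap fB)).
- exact: bounded_lap_dom (bounded_Gamma fB fB).
Qed.

Lemma GammaD B C f g c x : bounded_by B f -> bounded_by C g ->
  Gamma G (fun y => c * g y + f y) (fun y => c * g y + f y) x =
  Gamma G f f x + 2 * c * Gamma G f g x + c ^+ 2 * Gamma G g g x.
Proof.
move=> fB gC; rewrite /Gamma.
have ffd := bounded_lap_dom (bounded_byM fB fB).
have fgd := bounded_lap_dom (bounded_byM fB gC).
have ggd := bounded_lap_dom (bounded_byM gC gC).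
have fd := bounded_lap_dom fB; have gd := bounded_lap_dom gC.
have -> : (fun y => c * g y + f y) \* (fun y => c * g y + f y) =
    (fun y => c ^+ 2 * (g \* g) y + (2 * c * (f \* g) y + (f \* f) y)).
  by apply/funext => y /=; ring.
by rewrite !lapD//; [ring|exact: lap_domD].
Qed.

Definition heat_step h f : V -> R := fun x => h * lap G f x + f x.

Context (h : R) (h0 : 0 <= h) (hD1 : h * D <= 1).
Local Notation Q := (heat_step h).

Lemma heat_stepD a B C f g : bounded_by B f -> bounded_by C g ->
  Q (fun y => a * f y + g y) = (fun x => a * Q f x + Q g x).
Proof.
move=> /bounded_lap_dom fd /bounded_lap_dom gd; apply/funext => x.
by rewrite /heat_step lapD//; ring.
Qed.

Lemma heat_step_cst c : Q (fun=> c) = (fun=> c).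
Proof. by apply/funext => x; rewrite /heat_step lap_cst mulr0 add0r. Qed.

(** For [F = g - f >= 0], [lap_ge] gives [Q F x >= (1 - h * Deg G x) * F x], and [h * D <= 1] keeps
    this factor nonnegative. *)
Lemma heat_step_le B C f g : bounded_by B f -> bounded_by C g ->
  (forall y, f y <= g y) -> forall x, Q f x <= Q g x.
Proof.
move=> fB gC fg x; rewrite -subr_ge0.
have fd := bounded_lap_dom fB; have gd := bounded_lap_dom gC.
have {}fg y : 0 <= -1 * f y + g y by have := fg y; lra.
have -> : Q g x - Q f x = Q (fun y => -1 * f y + g y) x.
  by rewrite (heat_stepD _ fB gC); lra.
rewrite /heat_step; have := ler_wpM2l h0 (lap_ge hlf x (lap_domD (-1) fd gd) fg).
set F := _ + g x; have F0 : 0 <= F by exact: fg.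
have : h * (Deg G x * F) <= F.
  rewrite mulrA; apply: ler_piMl => //.
  exact: le_trans (ler_wpM2l h0 (hD x)) hD1.
lra.
Qed.

Lemma bounded_heat_step B f : bounded_by B f -> bounded_by B (Q f).
Proof.
move=> fB x.
have lo y : - B <= f y by have := fB y; rewrite ler_norml => /andP[].
have hi y : f y <= B by have := fB y; rewrite ler_norml => /andP[].
rewrite ler_norml; have := heat_step_le (@bounded_by_cst (- B)) fB lo x.
have := heat_step_le fB (@bounded_by_cst B) hi x.
by rewrite !heat_step_cst => -> ->.
Qed.

(** Jensen for the Markov operator [Q]: apply it to [(f - c) ^+ 2 >= 0] with [c = Q f x], using that
    [Q] fixes constants. *)
Lemma heat_step_sqr B f x : bounded_by B f -> Q f x ^+ 2 <= Q (f \* f) x.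
Proof.
move=> fB; set c := Q f x; have ffB := bounded_byM fB fB.
have cB := @bounded_by_cst (c ^+ 2).
have sqB := bounded_byD (-2 * c) fB (bounded_byD 1 ffB cB).
have nonneg y : 0 <= -2 * c * f y + (1 * (f \* f) y + c ^+ 2).
  by have := sqr_ge0 (f y - c); rewrite /=; lra.
have := heat_step_le (@bounded_by_cst 0) sqB nonneg x.
rewrite (heat_stepD _ fB (bounded_byD 1 ffB cB)) (heat_stepD _ ffB cB).
by rewrite !heat_step_cst -/c; lra.
Qed.

Lemma lap_heat_step B f : bounded_by B f -> lap G (Q f) = Q (lap G f).
Proof.
move=> fB; apply/funext => x; rewrite [LHS]lapD//.
  exact: bounded_lap_dom (bounded_lap fB).
exact: bounded_lap_dom fB.
Qed.

Lemma bounded_iter N B f : bounded_by B f -> bounded_by B (iter N Q f).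
Proof. by elim: N => // N IH fB /=; exact/bounded_heat_step/IH. Qed.

Lemma iter_heat_stepD N a B C f g : bounded_by B f -> bounded_by C g ->
  iter N Q (fun y => a * f y + g y) =
  (fun x => a * iter N Q f x + iter N Q g x).
Proof.
move=> fB gC; elim: N => // N /= ->.
exact: heat_stepD (bounded_iter N fB) (bounded_iter N gC).
Qed.

Lemma iter_heat_step_cst N c : iter N Q (fun=> c) = (fun=> c).
Proof. by elim: N => // N /= ->; rewrite heat_step_cst. Qed.

Lemma iter_heat_step_le N B C f g : bounded_by B f -> bounded_by C g ->
  (forall y, f y <= g y) -> forall x, iter N Q f x <= iter N Q g x.
Proof.
move=> fB gC fg; elim: N => // N IH.
exact: heat_step_le (bounded_iter N fB) (bounded_iter N gC) IH.
Qed.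

Lemma iter_heat_step_sqr N B f x : bounded_by B f ->
  iter N Q f x ^+ 2 <= iter N Q (f \* f) x.
Proof.
move=> fB; elim: N x => // N IH x /=.
apply: le_trans (heat_step_sqr x (bounded_iter N fB)) _.
have fNB := bounded_iter N fB.
exact: heat_step_le (bounded_byM fNB fNB) (bounded_iter N (bounded_byM fB fB)) IH x.
Qed.

Lemma lap_iter_heat_step N B f : bounded_by B f ->
  lap G (iter N Q f) = iter N Q (lap G f).
Proof.
by move=> fB; elim: N => // N IH /=; rewrite (lap_heat_step (bounded_iter N fB)) IH.
Qed.

End HeatStep.

(** * Discrete gradient estimate *)

Section GradientEstimate.
Context (R : realType) (V : countType) (G : wgraph R V).
Context (hlf : locally_finite G) (D : R) (hD : forall x, Deg G x <= D).
Context (K n : R) (hK : 0 < K) (hn : 0 < n) (hCD : CD G K n%:E).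
Context (B : R) (B0 : 0 <= B) (D0 : 0 <= D).
Implicit Types (f u : V -> R) (h : R).

(* One Euler step loses O(h^2) with respect to the Bochner-type inequality
   satisfied by the heat semigroup. *)
Definition step_error : R :=
  12 * D ^+ 3 * B ^+ 2 + 2 * K * (12 * D ^+ 2 * B ^+ 2 + 12 * D ^+ 3 * B ^+ 2)
  + 2 / n * (16 * D ^+ 3 * B ^+ 2 + 16 * D ^+ 4 * B ^+ 2).

Lemma step_error_ge0 : 0 <= step_error.
Proof.
by rewrite /step_error !addr_ge0 ?mulr_ge0 ?exprn_ge0 ?addr_ge0 ?mulr_ge0
  ?exprn_ge0 ?invr_ge0 ?(ltW hK) ?(ltW hn).
Qed.

(** By [CD], [h * lap G (Gamma G u u)] dominates [2 * h] times [lap G u ^+ 2 / n + K * Gamma G u u +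
    Gamma G u (lap G u)]. The last term is the first-order term of [Gamma] at the new function, so
    both sides agree to order [h]; what remains is collected in [step_error]. *)
Lemma Gamma_heat_step h u x : 0 <= h -> h <= 1 -> bounded_by B u ->
  (1 + 2 * h * K) * Gamma G (heat_step G h u) (heat_step G h u) x
  + (2 * h / n * lap G (heat_step G h u) x ^+ 2 - step_error * h ^+ 2)
  <= heat_step G h (Gamma G u u) x.
Proof.
move=> h0 h1 uB; have luB := bounded_lap hlf hD uB.
have lluB := bounded_lap hlf hD luB.
have ud := bounded_lap_dom hlf uB; have lud := bounded_lap_dom hlf luB.
rewrite (GammaD hlf h x uB luB) [lap G (heat_step G h u) x]lapD//.
have := hCD (bounded_Gamma2_dom hlf hD uB) x.
have := bounded_Gamma hlf hD luB luB x; have := bounded_Gamma hlf hD uB luB x.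
have := lluB x; have := luB x.
rewrite /Gamma2 /heat_step /= inver gt_eqF//=.
move: (Gamma G u u x) (Gamma G u (lap G u) x)
  (Gamma G (lap G u) (lap G u) x) (lap G (Gamma G u u) x).
move: (lap G u x) (lap G (lap G u) x) => l ll E P S X hl hll hP hS CDx.
have bP : P <= 6 * D ^+ 2 * B ^+ 2.
  by have := ler_norm P; lra.
have bS : S <= 12 * D ^+ 3 * B ^+ 2.
  by have := ler_norm S; lra.
have bl : l * ll <= 8 * D ^+ 3 * B ^+ 2.
  apply: le_trans (ler_norm _) _; rewrite normrM.
  by apply: le_trans (ler_pM _ _ hl hll) _ => //; lra.
have bll : ll ^+ 2 <= 16 * D ^+ 4 * B ^+ 2.
  rewrite -real_normK ?num_real// expr2.
  by apply: le_trans (ler_pM _ _ hll hll) _ => //; lra.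
have cS0 : 0 <= 12 * D ^+ 3 * B ^+ 2 by rewrite !mulr_ge0 ?exprn_ge0.
have cll0 : 0 <= 16 * D ^+ 4 * B ^+ 2 by rewrite !mulr_ge0 ?exprn_ge0.
(* With [h <= 1], terms of order three in [h] are absorbed into those of order two. *)
have hh : h ^+ 2 <= h by rewrite expr2 ler_piMr.
have ni0 : 0 <= n^-1 by rewrite invr_ge0 ltW.
rewrite {hl hll hP hS} /step_error.
have -> : 12 * D ^+ 2 * B ^+ 2 = 2 * (6 * D ^+ 2 * B ^+ 2) by ring.
have -> : 16 * D ^+ 3 * B ^+ 2 = 2 * (8 * D ^+ 3 * B ^+ 2) by ring.
move: (n^-1) (6 * D ^+ 2 * _) (12 * D ^+ 3 * _) (8 * D ^+ 3 * _)
  (16 * D ^+ 4 * _) => ni cP cS cl cll in CDx bP bS bl bll cS0 cll0 ni0 *.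
have h2S : h ^+ 2 * S <= h ^+ 2 * cS by rewrite ler_wpM2l ?sqr_ge0.
have h2cS : h ^+ 2 * cS <= h * cS by rewrite ler_wpM2r.
have h2ll : h ^+ 2 * ll ^+ 2 <= h * cll.
  exact: le_trans (ler_wpM2l (sqr_ge0 h) bll) (ler_wpM2r cll0 hh).
have hl : h * (l * ll) <= h * cl by rewrite ler_wpM2l.
have hP : h * P <= h * cP by rewrite ler_wpM2l.
have t2 : 2 * h * K * (E + 2 * h * P + h ^+ 2 * S) <=
    2 * h * K * (E + h * (2 * cP + cS)).
  by rewrite ler_wpM2l ?mulr_ge0 ?(ltW hK)//; lra.
have t3 : 2 * h * ni * (h * ll + l) ^+ 2 <=
    2 * h * ni * (l ^+ 2 + h * (2 * cl + cll)).
  by rewrite ler_wpM2l ?mulr_ge0//; lra.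
have := ler_wpM2l h0 CDx; lra.
Qed.

Local Notation Q h := (heat_step G h).

(** Induction peeling off the first step: [Gamma_heat_step] is pushed through the monotone operator
    [Q ^ N], the [Gamma] term is handled by the induction hypothesis at [Q h u], and the squared
    Laplacian by Jensen and commutation. The coefficient is the geometric sum of ratio
    [1 + 2 * h * K]. *)
Lemma Gamma_iter_heat_step N h u x : 0 < h -> h <= 1 -> h * D <= 1 ->
  bounded_by B u ->
  (1 + 2 * h * K) ^+ N * Gamma G (iter N (Q h) u) (iter N (Q h) u) x
  + ((1 + 2 * h * K) ^+ N - 1) / (2 * h * K) *
    (2 * h / n * lap G (iter N (Q h) u) x ^+ 2 - step_error * h ^+ 2)
  <= iter N (Q h) (Gamma G u u) x.
Proof.
move=> h0 h1 hD1; have h0' := ltW h0; elim: N u => [|N IH] u uB.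
  by rewrite /= expr0 subrr !mul0r addr0 mul1r.
set q := 1 + 2 * h * K; rewrite [iter N.+1 _ (Gamma G u u)]iterSr.
have QuB := bounded_heat_step hlf hD h0' hD1 uB.
have GQB := bounded_Gamma hlf hD QuB QuB.
have GuB := bounded_heat_step hlf hD h0' hD1 (bounded_Gamma hlf hD uB uB).
have lQB := bounded_lap hlf hD QuB.
have lQ2B := bounded_byM lQB lQB.
have cB := @bounded_by_cst R V (- (step_error * h ^+ 2)).
have tailB := bounded_byD (2 * h / n) lQ2B cB.
have step y : q * Gamma G (Q h u) (Q h u) y +
    (2 * h / n * (lap G (Q h u) \* lap G (Q h u)) y - step_error * h ^+ 2)
    <= Q h (Gamma G u u) y.
  by have := Gamma_heat_step y h0' h1 uB; rewrite expr2.
have := iter_heat_step_le hlf hD h0' hD1 N (bounded_byD q GQB tailB) GuB step x.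
apply: le_trans.
rewrite (iter_heat_stepD hlf hD h0' hD1 N q GQB tailB).
rewrite (iter_heat_stepD hlf hD h0' hD1 N _ lQ2B cB) iter_heat_step_cst.
have := iter_heat_step_sqr hlf hD h0' hD1 N x lQB.
rewrite -(lap_iter_heat_step hlf hD h0' hD1 N QuB) -iterSr.
have := IH _ QuB; rewrite -/q -!iterSr.
have q1 : 2 * h * K = q - 1 by rewrite /q; ring.
have q0 : 0 < q - 1 by rewrite -q1 !mulr_gt0.
rewrite q1 => IHx sqx.
have {}IHx := ler_wpM2l (_ : 0 <= q) IHx.
have {}sqx : 2 * h / n * lap G (iter N.+1 (Q h) u) x ^+ 2 <=
    2 * h / n * iter N (Q h) (lap G (Q h u) \* lap G (Q h u)) x.
  by rewrite ler_wpM2l// !mulr_ge0 ?invr_ge0 ?ltW.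
have {}IHx := IHx _; apply: le_trans (lerD (IHx _) (lerD sqx (lexx _))); last lra.
(* The geometric sum satisfies [S_(N+1) = q * S_N + 1]. *)
rewrite le_eqVlt; apply/orP; left; apply/eqP; rewrite exprS; field.
by rewrite !gt_eqF.
Qed.

End GradientEstimate.

(** * Distance travelled by the flow *)

(** Mean value theorem: the derivative of [asin] increases on [[0, 1[], so the slope at the left end
    bounds the secant slope from below. *)
Lemma asinB_ge (R : realType) (a b : R) : 0 <= a -> a <= b -> b < 1 ->
  (b - a) / Num.sqrt (1 - a ^+ 2) <= asin b - asin a.
Proof.
move=> a0; rewrite le_eqVlt => /predU1P[->|ab b1]; first by rewrite !subrr mul0r.
have drv x : x \in `]a, b[ -> is_derive x 1 (@asin R) (Num.sqrt (1 - x ^+ 2))^-1.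
  by rewrite in_itv/= => /andP[ax xb]; apply: is_derive1_asin; lra.
have [|c] := MVT ab drv.
  apply: continuous_in_subspaceT => x; rewrite inE/= in_itv/= => /andP[ax xb].
  by apply: continuous_asin; lra.
rewrite in_itv/= => /andP[ac cb] ->; rewrite mulrC ler_wpM2r//; first lra.
have c2 : 0 < 1 - c ^+ 2.
  by rewrite subr_gt0 exprn_ilt1//; [exact/ltW/(le_lt_trans a0)|exact: lt_trans b1].
have acsqr : a ^+ 2 <= c ^+ 2 by rewrite lerXn2r ?nnegrE; lra.
by rewrite lef_pV2 ?posrE ?sqrtr_gt0 ?ler_wsqrtr//; lra.
Qed.

Lemma asin_ge0 (R : realType) (x : R) : 0 <= x -> x < 1 -> 0 <= asin x.
Proof.
move=> x0 x1; have asin0 : asin 0 = 0 :> R.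
  rewrite -[in LHS]sin0 sinK// in_itv/= oppr_le0.
  by rewrite divr_ge0 ?pi_ge0.
have := asinB_ge (lexx 0) x0 x1; rewrite asin0 !subr0; apply: le_trans.
by rewrite divr_ge0 ?sqrtr_ge0.
Qed.

Section DistanceToFlow.
Context (R : realType) (V : countType) (G : wgraph R V).
Context (hlf : locally_finite G) (D : R) (hD : forall x, Deg G x <= D).
Context (K n : R) (hK : 0 < K) (hn : 0 < n) (hCD : CD G K n%:E).
Context (B : R) (B0 : 0 <= B) (D0 : 0 <= D).
Context (f : V -> R) (fB : bounded_by B f) (f1 : forall x, Gamma G f f x <= 1).
Implicit Types (x y : V) (h : R) (N M : nat).

Local Notation flow h N := (iter N (heat_step G h) f).

(* [decay h ^+ N] plays the role of [exp (- K t)] at time [t = N * h]. *)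
Definition decay h : R := (Num.sqrt (1 + 2 * h * K))^-1.

(** The per-step errors [step_error * h ^+ 2], summed geometrically and divided by
    [(1 + 2 * h * K) ^+ N], stay below [flow_error * h] for every [N]. *)
Definition flow_error : R := step_error D K n B / (2 * K).

Lemma flow_error_ge0 : 0 <= flow_error.
Proof.
by rewrite divr_ge0 ?step_error_ge0 ?mulr_ge0// ltW.
Qed.

Lemma decay_sqr h : 0 <= h -> decay h ^+ 2 = (1 + 2 * h * K)^-1.
Proof.
move=> h0; rewrite /decay exprVn sqr_sqrtr//.
by rewrite addr_ge0 ?mulr_ge0 ?(ltW hK).
Qed.

Lemma decay_gt0 h : 0 <= h -> 0 < decay h.
Proof.
by move=> h0; rewrite /decay invr_gt0 sqrtr_gt0 ltr_pwDl ?mulr_ge0 ?(ltW hK).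
Qed.

Lemma decay_le1 h : 0 <= h -> decay h <= 1.
Proof.
move=> h0; rewrite /decay invf_le1 ?sqrtr_gt0 ?ltr_pwDl ?mulr_ge0 ?(ltW hK)//.
by rewrite -[leLHS]sqrtr1 ler_wsqrtr// lerDl !mulr_ge0 ?(ltW hK).
Qed.

(** Divide [Gamma_iter_heat_step] by [(1 + 2 * h * K) ^+ N], whose inverse is the squared decay; the
    right-hand side is at most [1] because [Q] preserves [Gamma f <= 1]. *)
Lemma Gamma_flow_le h N x : 0 < h -> h <= 1 -> h * D <= 1 ->
  Gamma G (flow h N) (flow h N) x
  + (1 - (decay h ^+ N) ^+ 2) / (K * n) * lap G (flow h N) x ^+ 2
  <= (decay h ^+ N) ^+ 2 + flow_error * h.
Proof.
move=> h0 h1 hD1; have h0' := ltW h0.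
have := Gamma_iter_heat_step hlf hD hK hn hCD B0 D0 N x h0 h1 hD1 fB.
have GB := bounded_Gamma hlf hD fB fB.
have := iter_heat_step_le hlf hD h0' hD1 N GB (@bounded_by_cst R V 1) f1 x.
rewrite iter_heat_step_cst => Q1 /le_trans /(_ Q1).
rewrite exprAC decay_sqr// exprVn.
set Z := (1 + 2 * h * K) ^+ N.
have Z1 : 1 <= Z by rewrite exprn_ege1// lerDl !mulr_ge0 ?(ltW hK).
have Z0 : 0 < Z by exact: lt_le_trans Z1.
move: (Gamma _ _ _ _) (lap _ _ _) => g l.
have -> : (Z - 1) / (2 * h * K) * (2 * h / n * l ^+ 2 - step_error D K n B * h ^+ 2)
   = Z * ((1 - Z^-1) / (K * n) * l ^+ 2) - (Z - 1) * (flow_error * h).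
  by rewrite /flow_error; field; rewrite !gt_eqF.
move=> H.
rewrite -(ler_pM2l Z0) mulrDr.
have -> : Z * (Z^-1 + flow_error * h) = 1 + Z * (flow_error * h).
  by field; rewrite gt_eqF.
have := mulr_ge0 flow_error_ge0 h0'; lra.
Qed.

Lemma Gamma_flow_le_decay h N x : 0 < h -> h <= 1 -> h * D <= 1 ->
  Gamma G (flow h N) (flow h N) x <= (decay h ^+ N) ^+ 2 + flow_error * h.
Proof.
move=> h0 h1 hD1; apply: le_trans (Gamma_flow_le N x h0 h1 hD1).
rewrite lerDl mulr_ge0 ?sqr_ge0// divr_ge0 ?mulr_ge0 ?(ltW hK) ?(ltW hn)//.
have v0 := ltW (decay_gt0 (ltW h0)); have v1 := decay_le1 (ltW h0).
by rewrite subr_ge0 !exprn_ile1 ?exprn_ge0.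
Qed.

(** The argument of [asin] in [arcsin_term], without the case of isolated vertices, where this
    formula evaluates to [1]. *)
Definition asin_arg x : R := 1 / Num.sqrt (K * n / (2 * Deg G x) + 1).

Lemma asin_arg_denom_gt0 x : 0 < K * n / (2 * Deg G x) + 1.
Proof.
apply: ltr_wpDl => //; apply: divr_ge0; first exact/ltW/mulr_gt0.
exact: mulr_ge0 (Deg_ge0 hlf x).
Qed.

Lemma asin_arg_gt0 x : 0 < asin_arg x.
Proof.
by rewrite divr_gt0// sqrtr_gt0 asin_arg_denom_gt0.
Qed.

Lemma asin_arg_lt1 x : 0 < Deg G x -> asin_arg x < 1.
Proof.
move=> d0; rewrite /asin_arg div1r invf_lt1; last first.
  by rewrite sqrtr_gt0 asin_arg_denom_gt0.
rewrite -[ltLHS]sqrtr1 ltr_sqrt ?asin_arg_denom_gt0//.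
by rewrite ltrDr; apply: divr_gt0; exact: mulr_gt0.
Qed.

(** Eliminates [Gamma] between [Gamma_flow_le] and [lap_sqr_le]: with
    [K * n / (2 * Deg G x) = s ^-2 - 1], the coefficients of the squared Laplacian add up to
    [s ^-2 - v ^+ 2]. *)
Lemma lap_flow_le h N x : 0 < h -> h <= 1 -> h * D <= 1 -> 0 < Deg G x ->
  `|lap G (flow h N) x| <=
  Num.sqrt (K * n) *
  (asin_arg x * (decay h ^+ N + Num.sqrt (flow_error * h)) /
   Num.sqrt (1 - (asin_arg x * decay h ^+ N) ^+ 2)).
Proof.
move=> h0 h1 hD1 d0; have := Gamma_flow_le N x h0 h1 hD1.
have h0' := ltW h0.
have fd := bounded_Gamma_dom hlf (bounded_iter hlf hD h0' hD1 N fB).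
have := lap_sqr_le hlf x fd.
move: (Gamma _ _ _ _) (lap _ _ _) => g l lg.
have s0 := asin_arg_gt0 x; have s1 := asin_arg_lt1 d0.
have s2 : K * n / (2 * Deg G x) = (asin_arg x ^+ 2)^-1 - 1.
  rewrite /asin_arg div1r exprVn invrK sqr_sqrtr ?addrK//.
  exact/ltW/asin_arg_denom_gt0.
have v0 : 0 < decay h ^+ N by rewrite exprn_gt0// decay_gt0.
have v1 : decay h ^+ N <= 1 by rewrite exprn_ile1 ?decay_le1// ltW// decay_gt0.
have e0 := mulr_ge0 flow_error_ge0 h0'.
move: (asin_arg x) (decay h ^+ N) (flow_error * h) s0 s1 s2 v0 v1 e0.
move=> s v e s0 s1 s2 v0 v1 e0 H.
have Kn0 : 0 < K * n by rewrite mulr_gt0.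
have sv0 : 0 <= s * v by rewrite mulr_ge0// ltW.
have sv1 : s * v < 1 by rewrite (le_lt_trans _ s1)// ler_piMr// ltW.
have sv : 0 < 1 - (s * v) ^+ 2 by rewrite subr_gt0 exprn_ilt1.
rewrite -(ler_pXn2r (n := 2))// ?nnegrE//; last first.
  rewrite mulr_ge0 ?sqrtr_ge0// divr_ge0 ?sqrtr_ge0//.
  by rewrite mulr_ge0 ?addr_ge0 ?sqrtr_ge0 ?ltW.
rewrite real_normK ?num_real// exprMn sqr_sqrtr; last exact: ltW.
rewrite expr_div_n [X in _ / X]sqr_sqrtr; last exact: ltW.
rewrite mulrA ler_pdivlMr//.
(* Weakening to a perfect square separates the main term from the error once the root is taken. *)
have ve : v ^+ 2 + e <= (v + Num.sqrt e) ^+ 2.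
  have := mulr_ge0 (ltW v0) (sqrtr_ge0 e); have := sqr_sqrtr e0; lra.
have lb : l ^+ 2 * ((s ^+ 2)^-1 - 1) <= K * n * g.
  rewrite -s2 mulrA ler_pdivrMr; last exact: mulr_gt0.
  have := ler_wpM2l (ltW Kn0) lg; lra.
have {}H : (1 - v ^+ 2) * l ^+ 2 <= K * n * (v ^+ 2 + e - g).
  rewrite -ler_pdivrMl//; move: H.
  have -> : (1 - v ^+ 2) / (K * n) * l ^+ 2 =
      (K * n)^-1 * ((1 - v ^+ 2) * l ^+ 2) by ring.
  lra.
have -> : l ^+ 2 * (1 - (s * v) ^+ 2) =
    s ^+ 2 * (l ^+ 2 * ((s ^+ 2)^-1 - 1) + (1 - v ^+ 2) * l ^+ 2).
  by field; rewrite gt_eqF.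
have -> : K * n * (s * (v + Num.sqrt e)) ^+ 2 =
    s ^+ 2 * (K * n * (v + Num.sqrt e) ^+ 2) by ring.
rewrite ler_pM2l ?exprn_gt0//.
have := ler_wpM2l (ltW Kn0) ve; lra.
Qed.

(** Discrete form of [v dt = - dv / K]. With [q = 1 / decay h], [2 * h * K = (q - 1) * (q + 1)] and
    [q <= 1 + h * K]. *)
Lemma decay_gap h : 0 <= h -> h * decay h <= (K^-1 + h / 2) * (1 - decay h).
Proof.
move=> h0; rewrite /decay; set q := Num.sqrt _.
have hK0 : 0 <= h * K by rewrite mulr_ge0// ltW.
have q0 : 0 < q by rewrite sqrtr_gt0; lra.
have q2 : q ^+ 2 = 1 + 2 * h * K by rewrite sqr_sqrtr//; lra.
have q1 : q <= 1 + h * K.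
  rewrite -(ler_pXn2r (n := 2))// ?nnegrE ?(ltW q0)//; last lra.
  by rewrite q2; have := sqr_ge0 (h * K); lra.
have q1' : 1 <= q by rewrite -[leLHS]sqrtr1 ler_wsqrtr//; lra.
rewrite -(ler_pM2r q0) -(ler_pM2l hK).
have -> : K * (h / q * q) = h * K by field; rewrite gt_eqF.
have -> : K * ((K^-1 + h / 2) * (1 - q^-1) * q) = (1 + h * K / 2) * (q - 1).
  by field; rewrite !gt_eqF.
have := ler_wpM2r (_ : 0 <= q - 1) q1; rewrite subr_ge0 => /(_ q1'); lra.
Qed.

(** The sum starts at [flow h 1]: the step from time [M + 1] is charged to the [asin] increment
    between [s * decay h ^+ M.+1] and [s * decay h ^+ M], whose left end carries the denominator of
    [lap_flow_le]. The initial step would need an interval beyond [s]. *)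
Lemma flow_telescope h M x : 0 < h -> h <= 1 -> h * D <= 1 -> 0 < Deg G x ->
  `|flow h M.+1 x - flow h 1 x| <= Num.sqrt (K * n) *
  ((K^-1 + h / 2) * (asin (asin_arg x) - asin (asin_arg x * decay h ^+ M)) +
   M%:R * h * (asin_arg x * Num.sqrt (flow_error * h) /
               Num.sqrt (1 - asin_arg x ^+ 2))).
Proof.
move=> h0 h1 hD1 d0; elim: M => [|M IH].
  by rewrite expr0 mulr1 !subrr normr0 mulr0 mulr0n !mul0r addr0 mulr0.
have -> : flow h M.+2 x - flow h 1 x =
    h * lap G (flow h M.+1) x + (flow h M.+1 x - flow h 1 x).
  by rewrite addrA.
apply: le_trans (ler_normD _ _) _; rewrite normrM gtr0_norm//.
have := ler_wpM2l (ltW h0) (lap_flow_le M.+1 h0 h1 hD1 d0) => Hl.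
apply: le_trans (lerD Hl IH) _ => {Hl IH}.
rewrite mulrCA -mulrDr ler_wpM2l ?sqrtr_ge0//.
have gap := decay_gap (ltW h0).
have v0 : 0 <= decay h ^+ M by rewrite exprn_ge0// ltW// decay_gt0// ltW.
have v1 : decay h ^+ M <= 1.
  by rewrite exprn_ile1 ?decay_le1// ltW// ?decay_gt0// ltW.
have r0 := decay_gt0 (ltW h0); have r1 := decay_le1 (ltW h0).
have s0 := asin_arg_gt0 x; have s1 := asin_arg_lt1 d0.
rewrite exprS -[M.+1%:R]natr1.
have := sqrtr_ge0 (flow_error * h).
move: (asin_arg x) (decay h) (decay h ^+ M) (Num.sqrt (flow_error * h))
  s0 s1 v0 v1 r0 r1 gap.
move=> s r v e s0 s1 v0 v1 r0 r1 gap e0.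
have sv0 : 0 <= s * v by rewrite mulr_ge0// ltW.
have svs : s * v <= s by rewrite ler_piMr// ltW.
have svr : s * (r * v) <= s * v by rewrite ler_wpM2l ?(ltW s0)// ler_piMl.
have svr0 : 0 <= s * (r * v) by rewrite !mulr_ge0// ltW.
have := asinB_ge svr0 svr (le_lt_trans svs s1).
set S := Num.sqrt (1 - (s * _) ^+ 2) => asinb.
have svs2 : (s * (r * v)) ^+ 2 <= s ^+ 2.
  by rewrite lerXn2r ?nnegrE ?(ltW s0)//; lra.
have s2 : s ^+ 2 < 1 by rewrite exprn_ilt1// ltW.
have S0 : 0 < S by rewrite sqrtr_gt0; lra.
have T0 : 0 < Num.sqrt (1 - s ^+ 2) by rewrite sqrtr_gt0; lra.
have ST : S^-1 <= (Num.sqrt (1 - s ^+ 2))^-1.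
  by rewrite lef_pV2 ?posrE// ler_wsqrtr//; lra.
have part1 : h * (s * (r * v) / S) <=
    (K^-1 + h / 2) * (asin (s * v) - asin (s * (r * v))).
  have Kh : 0 <= K^-1 + h / 2 by have := invr_gt0 K; rewrite hK; lra.
  apply: le_trans (ler_wpM2l Kh asinb); rewrite !mulrA.
  rewrite ler_wpM2r ?invr_ge0 ?(ltW S0)//.
  have := ler_wpM2l sv0 gap; lra.
(* The error part only needs a bound independent of [M], hence the cruder denominator. *)
have part2 : h * (s * e / S) <= h * (s * e / Num.sqrt (1 - s ^+ 2)).
  by rewrite ler_wpM2l ?(ltW h0)// ler_wpM2l// mulr_ge0// ltW.
have -> : h * (s * (r * v + e) / S) = h * (s * (r * v) / S) + h * (s * e / S).
  by ring.
apply: le_trans (lerD (lerD part1 part2) (lexx _)) _.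
move: (s * e / _) (asin _) (asin (s * v)) (asin _) => *; lra.
Qed.

(** The constant is chosen before [h] and [M], so that the total time can later grow while the step
    shrinks. *)
Lemma flow_dist x : exists2 c, 0 <= c & forall h M,
  0 < h -> h <= 1 -> h * D <= 1 ->
  `|flow h M.+1 x - f x| <=
  Num.sqrt (n / K) * arcsin_term G K n x + c * (h + M%:R * h * Num.sqrt h).
Proof.
(* At an isolated vertex [lap_sqr_le] forces the Laplacian to vanish, so the flow stands still. *)
have [d0|] := eqVneq (Deg G x) 0.
  exists 0 => // h M h0 h1 hD1; rewrite /arcsin_term d0 eqxx mulr0 mul0r addr0.
  suff -> : forall N, flow h N x = f x by rewrite subrr normr0.
  elim=> //= N IH; rewrite /heat_step IH.
  have fd := bounded_Gamma_dom hlf (bounded_iter hlf hD (ltW h0) hD1 N fB).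
  have := lap_sqr_le hlf x fd; rewrite d0 mulr0 mul0r => l2.
  have /eqP : lap G (flow h N) x ^+ 2 = 0 by apply/le_anti; rewrite l2 sqr_ge0.
  by rewrite sqrf_eq0 => /eqP ->; rewrite mulr0 add0r.
move=> dn0; have d0 : 0 < Deg G x by rewrite lt0r dn0 Deg_ge0.
have s0 := asin_arg_gt0 x; have s1 := asin_arg_lt1 d0.
have as0 := asin_ge0 (ltW s0) s1.
(* [c1] collects the errors of order [h], from the initial step and from [h / 2] in [decay_gap];
   [c2] those of order [M * h * sqrt h]. *)
set c1 := 2 * D * B + Num.sqrt (K * n) * (asin (asin_arg x) / 2).
set c2 := Num.sqrt (K * n) *
  (asin_arg x * Num.sqrt flow_error / Num.sqrt (1 - asin_arg x ^+ 2)).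
have c1_ge0 : 0 <= c1.
  apply: addr_ge0; first by rewrite !mulr_ge0.
  by apply: mulr_ge0; [exact: sqrtr_ge0|exact: divr_ge0].
have c2_ge0 : 0 <= c2.
  apply: mulr_ge0; first exact: sqrtr_ge0.
  apply: divr_ge0; last exact: sqrtr_ge0.
  by apply: mulr_ge0; [exact: ltW|exact: sqrtr_ge0].
exists (c1 + c2) => [|h M h0 h1 hD1]; first exact: addr_ge0.
have -> : flow h M.+1 x - f x = (flow h M.+1 x - flow h 1 x) + h * lap G f x.
  by rewrite /= [in X in _ = _ - X + _]/heat_step; ring.
apply: le_trans (ler_normD _ _) _.
apply: le_trans (lerD (flow_telescope M h0 h1 hD1 d0) (lexx _)) _.
have lB : `|h * lap G f x| <= h * (2 * D * B).
  rewrite normrM gtr0_norm// ler_wpM2l ?(ltW h0)//.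
  exact: (bounded_lap hlf hD fB).
have r0 : 0 <= asin (asin_arg x * decay h ^+ M).
  have v0 : 0 <= decay h ^+ M by rewrite exprn_ge0// ltW// decay_gt0// ltW.
  have v1 : decay h ^+ M <= 1.
    by rewrite exprn_ile1 ?decay_le1// ltW// ?decay_gt0// ltW.
  apply: asin_ge0; first exact: mulr_ge0 (ltW s0) v0.
  by apply: le_lt_trans s1; rewrite ler_piMr// ltW.
have -> : arcsin_term G K n x = asin (asin_arg x).
  by rewrite /arcsin_term (negbTE dn0).
have sqnK : Num.sqrt (n / K) = Num.sqrt (K * n) / K.
  have -> : n / K = K * n * (K^-1) ^+ 2 by field; rewrite gt_eqF.
  rewrite sqrtrM ?mulr_ge0 ?(ltW hK) ?(ltW hn)// sqrtr_sqr gtr0_norm//.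
  by rewrite invr_gt0.
rewrite sqnK [Num.sqrt (flow_error * h)]sqrtrM ?flow_error_ge0//.
set e := Num.sqrt h; set k := Num.sqrt (K * n).
have Mhe0 : 0 <= M%:R * h * e by rewrite !mulr_ge0 ?sqrtr_ge0// ltW.
have k0 : 0 <= k := sqrtr_ge0 _.
have drop : k * ((K^-1 + h / 2) *
      (asin (asin_arg x) - asin (asin_arg x * decay h ^+ M))) <=
    k * ((K^-1 + h / 2) * asin (asin_arg x)).
  rewrite ler_wpM2l// ler_wpM2l ?gerBl//.
  by rewrite addr_ge0 ?invr_ge0 ?divr_ge0// ltW.
have -> : M%:R * h * (asin_arg x * (Num.sqrt flow_error * e) /
   Num.sqrt (1 - asin_arg x ^+ 2)) = M%:R * h * e *
   (asin_arg x * Num.sqrt flow_error / Num.sqrt (1 - asin_arg x ^+ 2)) by ring.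
(* These cross terms are nonnegative, so the single constant [c1 + c2] serves both error scales. *)
have := mulr_ge0 c1_ge0 Mhe0; have := mulr_ge0 c2_ge0 (ltW h0).
rewrite /c1 /c2 -/k => *; lra.
Qed.

End DistanceToFlow.

(** * Resistance distance *)

Lemma bernoulli_ineq (R : realDomainType) (y : R) N :
  0 <= y -> 1 + N%:R * y <= (1 + y) ^+ N.
Proof.
move=> y0; elim: N => [|N IH]; first by rewrite mul0r addr0 expr0.
have y1 : 0 <= 1 + y by rewrite addr_ge0.
rewrite exprS; apply: le_trans (ler_wpM2l y1 IH).
rewrite -[N.+1%:R]natr1.
have : 0 <= N%:R * (y * y) by rewrite !mulr_ge0.
lra.
Qed.

Lemma clamp_contraction (R : realDomainType) (a b s t : R) :
  `|Num.max a (Num.min b s) - Num.max a (Num.min b t)| <= `|s - t|.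
Proof.
have st := ler_norm (s - t); have := ler_norm (t - s); rewrite distrC => ts.
rewrite ler_norml; have := normr_ge0 (s - t).
case: (leP b s) => ?; case: (leP b t) => ?; case: (leP a b) => ?;
  case: (leP a s) => ?; case: (leP a t) => ? ?; lra.
Qed.

Section Diameter.
Context (R : realType) (V : countType) (G : wgraph R V).
Context (hlf : locally_finite G).

(** The constant sums [sqrt (2 * m x / w x y)] over the edges and depends on the path alone, so a
    uniformly small [Gamma] forces nearby values at its ends. *)
Lemma path_dist x p : path (adj G) x p -> exists2 c : R, 0 <= c &
  forall g E, Gamma_dom G g -> (forall z, Gamma G g g z <= E) ->
    `|g (last x p) - g x| <= c * Num.sqrt E.
Proof.
elim: p x => [x _|y p IH x /= /andP[xy yp]].
  by exists 0 => // g E _ _; rewrite subrr normr0 mul0r.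
have [c c0 Hc] := IH _ yp.
exists (c + Num.sqrt (2 * vmeas G x / weight G x y)) => [|g E gd gE].
  by rewrite addr_ge0 ?sqrtr_ge0.
have -> : g (last y p) - g x = (g (last y p) - g y) + (g y - g x) by ring.
apply: le_trans (ler_normD _ _) _; rewrite mulrDl lerD ?Hc//.
have w0 : 0 <= 2 * vmeas G x / weight G x y.
  by rewrite divr_ge0 ?mulr_ge0 ?weight_ge0// ltW// vmeas_gt0.
rewrite -sqrtrM// -sqrtr_sqr ler_wsqrtr//.
exact: le_trans (Gamma_adj gd xy) (ler_wpM2l w0 (gE x)).
Qed.

Context (D : R) (hD : forall x, Deg G x <= D).
Context (hconn : connected_wgraph G).
Context (K n : R) (hK : 0 < K) (hn : 0 < n) (hCD : CD G K n%:E).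

(** Go from [f x] to [f y] through the flow at a late time: [flow_dist] controls both ends and
    [path_dist] the middle. *)
Lemma dist_bounded_le B f x y : bounded_by B f ->
  (forall z, Gamma G f f z <= 1) ->
  `|f y - f x| <=
  Num.sqrt (n / K) * (arcsin_term G K n x + arcsin_term G K n y).
Proof.
move=> fB f1.
have B0 : 0 <= B by apply: le_trans (fB x).
have D0 : 0 <= D by apply: le_trans (hD x); exact: Deg_ge0.
have [cx cx0 Hx] := flow_dist hlf hD hK hn hCD B0 D0 fB f1 x.
have [cy cy0 Hy] := flow_dist hlf hD hK hn hCD B0 D0 fB f1 y.
have [p [xp xy]] := hconn x y.
have [cp cp0 Hp] := path_dist xp; rewrite {}xy in Hp.
have C0 := flow_error_ge0 hK hn B0 D0.
set C := flow_error D K n B in C0.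
(* [W / j ^+ 2] will bound [Gamma] of the late flow: [(2 * K)^-1] accounts for the decay, [C] for
   the accumulated error. *)
set W := (2 * K)^-1 + C.
set c := 2 * cx + 2 * cy + cp * Num.sqrt W.
have W0 : 0 <= W by apply: addr_ge0 => //; rewrite invr_ge0 mulr_ge0// ltW.
have c0 : 0 <= c by rewrite !addr_ge0 ?mulr_ge0 ?sqrtr_ge0.
apply/ler_addgt0Pr => e e0.
(* This size of [j] ensures [1 <= j], [h * D <= 1] and [c / j <= e]. *)
pose J := Num.bound (1 + D + c / e); pose j : R := J%:R.
have ce0 : 0 <= c / e by rewrite divr_ge0// ltW.
have jJ : 1 + D + c / e < j by apply: archi_boundP; rewrite !addr_ge0.
have j0 : 0 < j by lra.
have j1 : 1 <= j by lra.
have jX N : 1 <= j ^+ N by exact: exprn_ege1.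
(* Time step [J^-8] and [J^10] steps: the total time [J^2] tends to infinity
   while the accumulated error [J^2 * J^-4] tends to zero. *)
pose h : R := (j ^+ 4)^-1 ^+ 2; pose M := (J ^ 10)%N.
have MR : M%:R = j ^+ 10 by rewrite natrX.
have h0 : 0 < h by rewrite exprn_gt0// invr_gt0 exprn_gt0.
have h1 : h <= 1.
  by rewrite exprn_ile1 ?invr_ge0 ?exprn_ge0 ?(ltW j0)// invf_le1 ?exprn_gt0.
have hj : h * j <= 1.
  have -> : h * j = (j ^+ 7)^-1 by rewrite /h; field; rewrite gt_eqF.
  by rewrite invf_le1 ?exprn_gt0.
have hD1 : h * D <= 1.
  by apply: le_trans hj; rewrite ler_wpM2l ?(ltW h0)//; lra.
have err : h + M%:R * h * Num.sqrt h <= 2 / j.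
  (* The step was written as a square so that its root is explicit. *)
  have -> : Num.sqrt h = (j ^+ 4)^-1.
    by rewrite /h sqrtr_sqr ger0_norm// invr_ge0 exprn_ge0// ltW.
  have -> : M%:R * h * (j ^+ 4)^-1 = j^-1 * j^-1.
    by rewrite MR /h; field; rewrite gt_eqF.
  have : h <= j^-1 by rewrite -(ler_pM2r j0) mulVf ?gt_eqF.
  have : j^-1 * j^-1 <= j^-1 by rewrite ler_piMr ?invr_ge0 ?invf_le1 ?(ltW j0).
  lra.
have {}Hx := le_trans (Hx h M h0 h1 hD1) (lerD (lexx _) (ler_wpM2l cx0 err)).
have {}Hy := le_trans (Hy h M h0 h1 hD1) (lerD (lexx _) (ler_wpM2l cy0 err)).
set g := iter M.+1 (heat_step G h) f in Hx Hy.
have gB : bounded_by B g := bounded_iter hlf hD (ltW h0) hD1 M.+1 fB.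
have gE z : Gamma G g g z <= W / j ^+ 2.
  have := Gamma_flow_le_decay hlf hD hK hn hCD B0 D0 fB f1 M.+1 z h0 h1 hD1.
  move=> /le_trans; apply.
  rewrite exprAC decay_sqr ?(ltW h0)// exprVn -/C [W / _]mulrDl lerD//.
    have hK0 : 0 <= 2 * h * K by apply/ltW/mulr_gt0 => //; apply: mulr_gt0.
    (* Since [M * h = j ^+ 2], linear growth already gives [(1 + 2 * h * K) ^+ M.+1 >= 2 * K * j ^+
       2]. *)
    have := bernoulli_ineq M.+1 hK0.
    rewrite -invfM lef_pV2 ?posrE; last 2 first.
    - by rewrite exprn_gt0// ltr_pwDl.
    - by rewrite !mulr_gt0// exprn_gt0.
    apply: le_trans.
    have -> : 2 * K * j ^+ 2 = M%:R * (2 * h * K).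
      by rewrite MR /h; field; rewrite gt_eqF.
    by rewrite -[M.+1%:R]natr1; lra.
  rewrite ler_wpM2l// /h exprVn lef_pV2 ?posrE ?exprn_gt0//.
  have -> : (j ^+ 4) ^+ 2 = j ^+ 2 * j ^+ 6 by ring.
  by rewrite ler_peMr// exprn_ge0// ltW.
have {}Hp := Hp g _ (bounded_Gamma_dom hlf gB) gE.
have sqW : Num.sqrt (W / j ^+ 2) = Num.sqrt W / j.
  by rewrite sqrtrM// -exprVn sqrtr_sqr ger0_norm// invr_ge0 ltW.
rewrite {}sqW in Hp.
have cj : c / j <= e.
  have := ltr_pM2l e0 (c / e) j; rewrite mulrC divfK ?gt_eqF// => cj.
  by rewrite ler_pdivrMr// ltW// cj; lra.
have -> : f y - f x = (f y - g y) + (g y - g x) + (g x - f x) by ring.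
rewrite distrC in Hy.
have := ler_normD (f y - g y + (g y - g x)) (g x - f x).
have := ler_normD (f y - g y) (g y - g x).
move: cj; rewrite /c => cj; lra.
Qed.

End Diameter.

Theorem theorem1p8 (R : realType) (V : countType) (G : wgraph R V) (K n : R)
    (hlf : locally_finite G) (hconn : connected_wgraph G)
    (hcompl : complete_wgraph G) (hnd : nondegenerate_measure G)
    (hK : 0 < K) (hn : 0 < n) (hCD : CD G K n%:E)
    (hDeg : (Deg_max G < +oo)%E) (x0 y0 : V) :
  (resistance_dist G x0 y0 <=
     (Num.sqrt (n / K) * (arcsin_term G K n x0 + arcsin_term G K n y0))%:E)%E.
Proof.
have DegD x : Deg G x <= fine (Deg_max G).
  (* [Deg_max] lies above a real number and below [+oo], so [fine] returns its true value. *)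
  have DegM : ((Deg G x)%:E <= Deg_max G)%E.
    by apply: ereal_sup_ubound; exists x.
  rewrite -lee_fin fineK// fin_numElt hDeg andbT.
  exact: lt_le_trans (ltNyr _) DegM.
apply: ge_ereal_sup => _ [f [fd f1] <-]; rewrite lee_fin.
wlog [B fB] : f fd f1 / exists B, bounded_by B f.
  (* Truncation between [f x0] and [f y0] does not increase [Gamma f]. *)
  move=> bounded_case.
  pose a := Num.min (f x0) (f y0); pose b := Num.max (f x0) (f y0).
  pose g y := Num.max a (Num.min b (f y)).
  have [gx gy] : g x0 = f x0 /\ g y0 = f y0.
    rewrite /g /a /b; case: (leP (f x0) (f y0)) => [|/ltW] xy.
      by rewrite minxx min_r// maxxx max_r.
    by rewrite minxx min_r// maxxx max_r.
  rewrite -gx -gy.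
  have gB : bounded_by (`|a| + `|b|) g.
    move=> y; have := normr_ge0 a; have := normr_ge0 b; rewrite /g.
    have := ler_norm b; have := ler_norm (- a); rewrite normrN.
    by case: (leP b (f y)); case: (leP a b); case: (leP a (f y)) => *;
      rewrite ?lerDl ?lerDr// ler_norml; lra.
  have gd := bounded_Gamma_dom hlf gB.
  apply: bounded_case => //; last by exists (`|a| + `|b|).
  move=> z; apply: le_trans (f1 z); apply: Gamma_le_contraction => // y y'.
  exact: clamp_contraction.
exact: (dist_bounded_le hlf DegD hconn hK hn hCD _ _ fB f1).
Qed.
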